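(* Let $A\in\mathbb{R}^{M\times N}$, $\bm b\in\mathbb{R}^M$, let $K\ge 2$ be an integer, let $\mu_k\in\mathbb{R}$ and $\sigma_k>0$ for $k=1,\dots,K$, and let $\lambda_n,\lambda_c,\lambda_t>0$. Let $\mathcal{B}$, $F$ and the alternating minimization sequence $\{(\bm x^n,\bm\delta^n,\bm\phi^n)\}_{n\ge 0}$ be defined as in the context, i.e. $\bm x^0=0$, $\delta^0_{jk}=\phi^0_{jk}=\frac1K$ for all $j,k$, and for $n\ge 0$ $$\bm x^{n+1}=\underset{\bm x\in\mathbb{R}^N}{\arg\min}\,F(\bm x,\bm\delta^n,\bm\phi^n),\qquad \bm\delta^{n+1}=\underset{\bm\delta\in\mathcal{B}}{\arg\min}\,F(\bm x^{n+1},\bm\delta,\bm\phi^n),\qquad \bm\phi^{n+1}=\underset{\bm\phi\in\mathcal{B}}{\arg\min}\,F(\bm x^{n+1},\bm\delta^{n+1},\bm\phi).$$ Then every cluster point of the sequence $\{(\bm x^n,\bm\delta^n,\bm\phi^n)\}$ is a coordinatewise minimum point of $F$.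
   Context: The $N$ indices $j=1,\dots,N$ enumerate the pixels of a rectangular two-dimensional image; $k=1,\dots,K$ indexes classes. Variables: $\bm x=(x_j)\in\mathbb{R}^N$, $\bm\delta=(\delta_{jk})\in\mathbb{R}^{N\times K}$ with columns $\bm\delta_k\in\mathbb{R}^N$, and $\bm\phi=(\phi_{jk})\in\mathbb{R}^{N\times K}$. Constraint set: $$\mathcal{B}=\Big\{\bm\xi\in\mathbb{R}^{N\times K}\ :\ \sum_{k=1}^K\xi_{jk}=1 \text{ and } \xi_{jk}\in(0,1)\text{ for all } j,k\Big\}.$$ Discrete total variation: $$R_{TV}(\bm\delta_k)=\sum_{j=1}^N\sqrt{(\delta_{j'k}-\delta_{jk})^2+(\delta_{j''k}-\delta_{jk})^2},$$ where $j'$ and $j''$ are the neighbor pixels of pixel $j$ in the horizontal and vertical directions respectively; at the boundary of the image domain the value of the nearest pixel is repeated (so the corresponding difference is $0$). The matrix $\nabla\in\mathbb{R}^{2N\times N}$ is the discrete gradient given by forward finite differences in the two directions with Neumann boundary condition. For $x_j\in\mathbb{R}$ and $\delta_{jk}>0$ put $$f_{jk}(x_j,\delta_{jk})=\frac{\delta_{jk}}{\sqrt{2\pi}\,\sigma_k}\exp\Big(-\frac{(x_j-\mu_k)^2}{2\sigma_k^2}\Big).$$ Objective function: for $(\bm x,\bm\delta,\bm\phi)\in\mathbb{R}^N\times\mathcal{B}\times\mathcal{B}$, $$F(\bm x,\bm\delta,\bm\phi)=\lambda_n\|A\bm x-\bm b\|_2^2+\lambda_t\|\nabla\bm x\|_2^2+\lambda_c\sum_{k=1}^K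 R_{TV}(\bm\delta_k)+\sum_{j=1}^N\Big[-\sum_{k=1}^K\phi_{jk}\ln f_{jk}(x_j,\delta_{jk})+\sum_{k=1}^K\phi_{jk}\ln\phi_{jk}\Big],$$ and $F=+\infty$ outside $\mathbb{R}^N\times\mathcal{B}\times\mathcal{B}$, so that $\operatorname{dom}F=\mathbb{R}^N\times\mathcal{B}\times\mathcal{B}$. The sequence is the infinite sequence of exact block minimizations, in the cyclic order $\bm x,\bm\delta,\bm\phi$ (no stopping test is applied). A point $\bm z=(\bm z_1,\bm z_2,\bm z_3)$, with blocks $\bm z_1\in\mathbb{R}^N$ and $\bm z_2,\bm z_3\in\mathbb{R}^{N\times K}$, is a coordinatewise minimum point of $F$ if $\bm z\in\operatorname{dom}F$ and $F$ does not decrease when any single block is changed: $F(\bm z_1+\bm d_1,\bm z_2,\bm z_3)\ge F(\bm z)$, $F(\bm z_1,\bm z_2+\bm d_2,\bm z_3)\ge F(\bm z)$ and $F(\bm z_1,\bm z_2,\bm z_3+\bm d_3)\ge F(\bm z)$ for all $\bm d_1\in\mathbb{R}^N$, $\bm d_2,\bm d_3\in\mathbb{R}^{N\times K}$.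
   Formalization: Only cluster points lying in dom F = R^N×B×B are covered; the iterates can converge to a boundary point outside dom F (e.g. N=M=1, K=2, A=1, b=0, μ=(0,1), σ=(1,1), all λ=1), which is not a coordinatewise minimum point. *)

(* Defs.v *)
From HB Require Import structures.
From mathcomp Require Import all_boot all_order all_algebra.
From mathcomp Require Import all_classical all_reals all_analysis.

Set Implicit Arguments.
Unset Strict Implicit.
Unset Printing Implicit Defensive.

Import Order.TTheory GRing.Theory Num.Theory.
Import numFieldNormedType.Exports.

Local Open Scope classical_set_scope.
Local Open Scope ring_scope.

Definition argmin (R : realType) (T : Type) (D : set T) (f : T -> \bar R) :
    set T :=
  [set x | D x /\ forall y, D y -> (f x <= f y)%E].

Definition dom (R : realType) (T : Type) (f : T -> \bar R) : set T :=
  [set x | (f x < +oo)%E].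

(* A sequence of points of D is regarded as a sequence in the topological space
   D, so its cluster points belong to D.  For D = dom F below this matters: D is
   not closed, and the iterates may converge in the ambient space to a point
   outside D (for one pixel, K = 2, A = 1, b = 0, mu = (0, 1), sigma = (1, 1),
   delta^n and phi^n tend to (1, 0)). *)
Definition cluster_points_in (T : topologicalType) (D : set T) (u : nat -> T) :
    set T :=
  D `&` cluster (u @ \oo).

Definition coordinatewise_min (R : realType) (X Y Z : zmodType)
    (F : X * Y * Z -> \bar R) (z : X * Y * Z) : Prop :=
  let: (z1, z2, z3) := z in
  [/\ dom F z,
      forall d1, (F z <= F ((z1 + d1)%R, z2, z3))%E,
      forall d2, (F z <= F (z1, (z2 + d2)%R, z3))%E
    & forall d3, (F z <= F (z1, z2, (z3 + d3)%R))%E].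

Definition sqnorm2 (R : realType) (n : nat) (v : 'cV[R]_n) : R :=
  \sum_i v i 0 ^+ 2.

(* The last index is its own successor: at the boundary of the image the
   nearest value is repeated. *)
Definition next (n : nat) (i : 'I_n) : 'I_n := insubd i i.+1.

Section Image.
Variables (R : realType) (H W N : nat).
(* [pix j] is the (row, column) position of the pixel number j, [idx] is the
   inverse enumeration. *)
Variables (pix : 'I_N -> 'I_H * 'I_W) (idx : 'I_H * 'I_W -> 'I_N).

Definition hnbr (j : 'I_N) : 'I_N := idx ((pix j).1, next (pix j).2).
Definition vnbr (j : 'I_N) : 'I_N := idx (next (pix j).1, (pix j).2).

Definition diff_mx (nbr : 'I_N -> 'I_N) : 'M[R]_N :=
  \matrix_(i, j) ((j == nbr i)%:R - (j == i)%:R).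

Definition nabla : 'M[R]_(N + N, N) := col_mx (diff_mx hnbr) (diff_mx vnbr).

Definition RTV (v : 'cV[R]_N) : R :=
  \sum_j Num.sqrt ((v (hnbr j) 0 - v j 0) ^+ 2 + (v (vnbr j) 0 - v j 0) ^+ 2).

Variables (M K : nat).

Definition simplexes : set 'M[R]_(N, K) :=
  [set xi | forall j, \sum_k xi j k = 1 /\ forall k, 0 < xi j k < 1].

Variables (A : 'M[R]_(M, N)) (b : 'cV[R]_M) (mu sigma : 'I_K -> R).
Variables (lambda_n lambda_t lambda_c : R).

Definition wgauss (k : 'I_K) (x d : R) : R :=
  d / (Num.sqrt (2 * pi) * sigma k)
  * expR (- ((x - mu k) ^+ 2 / (2 * sigma k ^+ 2))).

Definition energy (x : 'cV[R]_N) (delta phi : 'M[R]_(N, K)) : R :=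
  lambda_n * sqnorm2 (A *m x - b) + lambda_t * sqnorm2 (nabla *m x)
  + lambda_c * (\sum_k RTV (col k delta))
  + \sum_j (- (\sum_k phi j k * ln (wgauss k (x j 0) (delta j k)))
            + \sum_k phi j k * ln (phi j k)).

Definition objective (z : 'cV[R]_N * 'M[R]_(N, K) * 'M[R]_(N, K)) : \bar R :=
  let: (x, delta, phi) := z in
  if `[< simplexes delta /\ simplexes phi >] then (energy x delta phi)%:E
  else +oo%E.

Lemma dom_objective : dom objective = setT `*` simplexes `*` simplexes.
Proof.
apply/seteqP; split=> -[[x delta] phi]; rewrite /dom /objective /=.
  by case: asboolP => [[]|].
by move=> [[_ ?] ?]; rewrite asboolT ?ltry.
Qed.

(* [u n] is the n-th iterate (x^n, delta^n, phi^n). *)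
Definition alternating_minimization
    (u : nat -> 'cV[R]_N * 'M[R]_(N, K) * 'M[R]_(N, K)) : Prop :=
  let x n := (u n).1.1 in
  let delta n := (u n).1.2 in
  let phi n := (u n).2 in
  [/\ [/\ x 0%N = 0,
          delta 0%N = const_mx K%:R^-1
        & phi 0%N = const_mx K%:R^-1],
      forall n, argmin setT (fun y => objective (y, delta n, phi n)) (x n.+1),
      forall n, argmin simplexes (fun d => objective (x n.+1, d, phi n))
                  (delta n.+1)
    & forall n, argmin simplexes (fun p => objective (x n.+1, delta n.+1, p))
                  (phi n.+1)].

End Image.

(* Main.v *)
(* The energy e_n of the iterates is nonincreasing, and bounded below by the
   energy of the cluster point z, hence e_n - e_{n+1} -> 0.  For fixed phi in
   the product of simplexes, the energy is a quadratic function of x, strongly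
   convex uniformly in phi because sum_k phi_jk / sigma_k^2 is bounded below;
   hence |x^{n+1} - x^n|^2 = O(e_n - e_{n+1}), and x^{n+1} has the same limit as
   x^n along a subsequence converging to z.  Since the energy is continuous on
   its domain, the minimality properties of the iterates pass to the limit along
   that subsequence (represented below by a filter on nat finer than \oo). *)
Require Import Defs.
From mathcomp Require Import all_boot all_order all_algebra.
From mathcomp Require Import ring lra.
From mathcomp Require Import all_classical all_reals all_analysis.
Import numFieldNormedType.Exports.
Import Order.TTheory GRing.Theory Num.Theory.
Local Open Scope classical_set_scope.
Local Open Scope ring_scope.

(** * Convergence along filters and cluster points *)

Lemma cvg_mx {R : numFieldType} {m n : nat} {T : Type} (F : set_system T)
    {FF : Filter F} (f : T -> 'M[R]_(m, n)) (l : 'M[R]_(m, n)) :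
  (forall i j, f t i j @[t --> F] --> l i j) -> f @ F --> l.
Proof.
move=> fl; apply/cvg_ballP => e e0.
have : \forall t \near F, forall ij : 'I_m * 'I_n,
    ball (l ij.1 ij.2) e (f t ij.1 ij.2).
  apply: filter_forall => -[i j] /=; exact: (cvg_ball (fl i j)).
by apply: filterS => t ft; split => // i j; exact: (ft (i, j)).
Qed.

Lemma cluster_eventually_filter {T : topologicalType} (u : nat -> T) (z : T) :
  cluster (u @ \oo) z ->
  exists G : set_system nat, [/\ ProperFilter G, \oo `<=` G & u @ G --> z].
Proof.
move=> uz; exists [set A | exists B C,
  [/\ nbhs \oo B, nbhs z C & B `&` u @^-1` C `<=` A]]; split.
- split.
    move=> [B [C [BF Cz BC]]].
    have [_ [[n nB <-] nC]] : (u @` B) `&` C !=set0.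
      by apply: uz => //; apply: filterS BF => k Bk; exists k.
    exact: (BC n).
  split.
  + by exists setT, setT; split; [exact: filterT|exact: filterT|by []].
  + move=> P Q [B [C [BF Cz BC]]] [B' [C' [BF' Cz' BC']]].
    exists (B `&` B'), (C `&` C'); split; [exact: filterI|exact: filterI|].
    by move=> n [[? ?] [? ?]]; split; [exact: BC|exact: BC'].
  + by move=> P Q PQ [B [C [BF Cz BC]]]; exists B, C; split=> // n /BC /PQ.
- move=> A AF; exists A, setT; split; [by []|exact: filterT|by move=> n []].
- move=> C Cz; exists setT, C; split; [exact: filterT|by []|by move=> n []].
Qed.

(** * Strong convexity of the energy in the image block *)

Lemma sqnorm2_ge0 {R : realType} {n : nat} (v : 'cV[R]_n) : 0 <= sqnorm2 v.
Proof. by apply: sumr_ge0 => i _; exact: sqr_ge0. Qed.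

(** The parallelogram law, arranged to show the convexity defect at a midpoint. *)
Lemma sqnorm2_midpoint {R : realType} {n : nat} (v w : 'cV[R]_n) :
  sqnorm2 (2^-1 *: (v + w)) =
  (sqnorm2 v + sqnorm2 w) / 2 - sqnorm2 (v - w) / 4.
Proof.
rewrite /sqnorm2 -big_split /= !mulr_suml -sumrB.
by apply: eq_bigr => i _; rewrite !mxE; field.
Qed.

Section energy.
Context {R : realType} {H W N M K : nat}.
Context (pix : 'I_N -> 'I_H * 'I_W) (idx : 'I_H * 'I_W -> 'I_N).
Context (A : 'M[R]_(M, N)) (b : 'cV[R]_M) (mu sigma : 'I_K -> R).
Context (lambda_n lambda_t lambda_c : R).
Hypothesis sigma_gt0 : forall k, 0 < sigma k.

Let E := energy pix idx A b mu sigma lambda_n lambda_t lambda_c.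

Lemma wgauss_gt0 k x d : 0 < d -> 0 < wgauss mu sigma k x d.
Proof.
move=> d0; rewrite /wgauss mulr_gt0 ?expR_gt0// divr_gt0// mulr_gt0 //.
by rewrite sqrtr_gt0 mulr_gt0 // pi_gt0.
Qed.

Lemma ln_wgauss k x d : 0 < d ->
  ln (wgauss mu sigma k x d) =
  ln (d / (Num.sqrt (2 * pi) * sigma k)) - (x - mu k) ^+ 2 / (2 * sigma k ^+ 2).
Proof.
move=> d0; rewrite /wgauss lnM ?expRK // posrE ?expR_gt0 //.
by rewrite divr_gt0// mulr_gt0 // sqrtr_gt0 mulr_gt0 // pi_gt0.
Qed.

(** For [d] positive the logarithm of the weighted Gaussian splits into a constant in [x] minus a
    square. All terms are then constant or quadratic in [x], so the midpoint defect is exact. *)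
Lemma energy_midpoint (x y : 'cV[R]_N) (d p : 'M[R]_(N, K)) :
  (forall j k, 0 < d j k) ->
  E (2^-1 *: (x + y)) d p
  + (lambda_n * sqnorm2 (A *m (x - y))
     + lambda_t * sqnorm2 (nabla R pix idx *m (x - y))
     + \sum_j \sum_k p j k * ((x j 0 - y j 0) ^+ 2 / (2 * sigma k ^+ 2))) / 4
  = (E x d p + E y d p) / 2.
Proof.
move=> d0; rewrite /E /energy.
have -> : A *m (2^-1 *: (x + y)) - b = 2^-1 *: ((A *m x - b) + (A *m y - b)).
  rewrite -scalemxAr mulmxDr addrACA -opprD -mulr2n [RHS]scalerBr.
  by rewrite -[b *+ 2]scaler_nat scalerA mulVf ?pnatr_eq0// scale1r.
have -> : A *m (x - y) = (A *m x - b) - (A *m y - b).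
  by rewrite mulmxBr opprB addrA subrK.
rewrite -scalemxAr mulmxDr (mulmxBr (nabla _ _ _)).
rewrite !sqnorm2_midpoint.
set Lx := \sum_j (- _ + _ : R); set Q := \sum_j \sum_k _ * (_ / _).
set Ly := \sum_j (- (\sum_k _ * ln (wgauss _ _ _ (x _ _) _)) + _ : R).
set Lz := \sum_j (- (\sum_k _ * ln (wgauss _ _ _ (y _ _) _)) + _ : R).
have -> : Lx = (Ly + Lz) / 2 - Q / 4.
  rewrite /Lx /Ly /Lz /Q -big_split /= !mulr_suml -sumrB.
  apply: eq_bigr => j _.
  set Sx := (X in - X + _ + (_ + _)); set Sy := (X in _ + (- X + _)).
  set Sz := (X in - X + _ = _).
  suff -> : Sz = (Sx + Sy) / 2 + (\sum_k p j k *
      ((x j 0 - y j 0) ^+ 2 / (2 * sigma k ^+ 2))) / 4 by field.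
  rewrite /Sx /Sy /Sz -big_split /= !mulr_suml -big_split /=.
  apply: eq_bigr => k _; rewrite !ln_wgauss // !mxE.
  by field; rewrite gt_eqF.
by field.
Qed.

(** A minimizer [y] is compared with the midpoint of [x] and [y]: the midpoint identity then bounds
    half of the quadratic defect by the energy difference. The constant must not depend on [d] and
    [p], which vary along the iterates. *)
Lemma energy_gap : 0 < lambda_n -> 0 < lambda_t ->
  exists2 c : R, 0 < c & forall (x y : 'cV[R]_N) (d p : 'M[R]_(N, K)) j,
   simplexes d -> simplexes p -> (forall x', E y d p <= E x' d p) ->
   c * (x j 0 - y j 0) ^+ 2 <= E x d p - E y d p.
Proof.
move=> ln0 lt0.
have S0 : 0 <= \sum_k 2 * sigma k ^+ 2.
  by apply: sumr_ge0 => k _; rewrite mulr_ge0 ?sqr_ge0.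
(* Every [1 / (2 * sigma k ^+ 2)] is at least [c], hence so is any average of them with weights
   [p j k]. *)
set c := (1 + \sum_k 2 * sigma k ^+ 2)^-1.
have c0 : 0 < c by rewrite invr_gt0 ltr_pwDl.
exists (c / 2) => [|x y d p j sd sp miny]; first by rewrite divr_gt0.
have d0 j' k : 0 < d j' k by have [_ /(_ k)/andP[]] := sd j'.
have p0 j' k : 0 < p j' k by have [_ /(_ k)/andP[]] := sp j'.
have mid := energy_midpoint x y d p d0.
have ymid := miny (2^-1 *: (x + y)).
have nA := mulr_ge0 (ltW ln0) (sqnorm2_ge0 (A *m (x - y))).
have nD := mulr_ge0 (ltW lt0) (sqnorm2_ge0 (nabla R pix idx *m (x - y))).
set Q := \sum_j \sum_k _ in mid.
suff : c * (x j 0 - y j 0) ^+ 2 <= Q by lra.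
have t0 j' k : 0 <= p j' k * ((x j' 0 - y j' 0) ^+ 2 / (2 * sigma k ^+ 2)).
  by rewrite mulr_ge0 ?(ltW (p0 _ _)) // divr_ge0 ?sqr_ge0// mulr_ge0 ?sqr_ge0.
rewrite /Q (bigD1 j) //= ler_wpDr //.
  by apply: sumr_ge0 => i _; apply: sumr_ge0.
(* The factor 1 is written as the sum of the weights [p j k], so that the comparison is made term by
   term. *)
rewrite -[leLHS]mul1r -[X in X * _](sp j).1 mulr_suml; apply: ler_sum => k _.
rewrite ler_wpM2l ?(ltW (p0 _ _)) // mulrC ler_wpM2l ?sqr_ge0 //.
rewrite lef_pV2 ?posrE ?ltr_pwDl // ?mulr_gt0 ?exprn_gt0 //.
rewrite (bigD1 k) //= addrCA lerDl addr_ge0 // sumr_ge0 // => i _.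
by rewrite mulr_ge0 ?sqr_ge0.
Qed.

(** * Continuity of the energy on its domain *)

Lemma cvg_energy {T : Type} (F : set_system T) {FF : Filter F}
    (X : T -> 'cV[R]_N) (D P : T -> 'M[R]_(N, K))
    (x : 'cV[R]_N) (d p : 'M[R]_(N, K)) :
  X @ F --> x -> D @ F --> d -> P @ F --> p -> simplexes d -> simplexes p ->
  E (X t) (D t) (P t) @[t --> F] --> E x d p.
Proof.
move=> Xx Dd Pp sd sp.
have d0 j' k : 0 < d j' k by have [_ /(_ k)/andP[]] := sd j'.
have p0 j' k : 0 < p j' k by have [_ /(_ k)/andP[]] := sp j'.
have cX i j : X t i j @[t --> F] --> x i j.
  exact: (continuous_cvg _ (@coord_continuous _ _ _ i j x) Xx).
have cD i j : D t i j @[t --> F] --> d i j.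
  exact: (continuous_cvg _ (@coord_continuous _ _ _ i j d) Dd).
have cP i j : P t i j @[t --> F] --> p i j.
  exact: (continuous_cvg _ (@coord_continuous _ _ _ i j p) Pp).
have csum (I : finType) (f : I -> T -> R) (l : I -> R) :
    (forall i, f i t @[t --> F] --> l i) ->
    \sum_i f i t @[t --> F] --> \sum_i l i.
  by move=> fl; apply: cvg_big => //; exact: add_continuous.
have csq (f : T -> R) (l : R) : f t @[t --> F] --> l ->
    f t ^+ 2 @[t --> F] --> l ^+ 2.
  by move=> fl; under eq_fun do rewrite expr2; rewrite expr2; exact: cvgM.
have cmul m (B : 'M[R]_(m, N)) i : (B *m X t) i 0 @[t --> F] --> (B *m x) i 0.
  rewrite mxE; under eq_fun do rewrite mxE.
  by apply: csum => j; apply: cvgM => //; exact: cvg_cst.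
(* Used at limits that are positive because [d] and [p] lie in the open simplexes. *)
have cln (f : T -> R) (l : R) : 0 < l -> f t @[t --> F] --> l ->
    ln (f t) @[t --> F] --> ln l.
  by move=> l0 fl; exact: (continuous_cvg _ (continuous_ln l0) fl).
rewrite /E /energy.
apply: cvgD; [apply: cvgD; [apply: cvgD|]|].
- apply: cvgM; [exact: cvg_cst|apply: csum => i; apply: csq].
  rewrite mxE; under eq_fun do rewrite mxE.
  by apply: cvgD => //; exact: cvg_cst.
- apply: cvgM; [exact: cvg_cst|by apply: csum => i; apply: csq].
- apply: cvgM; [exact: cvg_cst|apply: (csum) => k; apply: csum => j].
  apply: (continuous_cvg _ (@sqrt_continuous R _)).
  by apply: cvgD; apply: (csq); rewrite !mxE; under eq_fun do rewrite !mxE;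
    apply: cvgB.
apply: (csum) => j; apply: cvgD; [apply: cvgN|]; apply: csum => k.
  apply: cvgM => //; apply: cln; first exact: wgauss_gt0.
  apply: cvgM; first by apply: cvgM => //; exact: cvg_cst.
  apply: (continuous_cvg _ (@continuous_expR R _)); apply: cvgN.
  apply: cvgM; last exact: cvg_cst.
  by apply: csq; apply: cvgB => //; exact: cvg_cst.
by apply: cvgM => //; exact: cln.
Qed.

End energy.

(** * The alternating iterates and their limits *)

Lemma simplexes_const {R : realType} (N K : nat) : (2 <= K)%N ->
  simplexes (const_mx K%:R^-1 : 'M[R]_(N, K)).
Proof.
move=> K2 j; have K0 : 0 < K%:R :> R by rewrite ltr0n ltnW.
split=> [|k]; last by rewrite mxE invr_gt0 K0 invf_lt1 ?ltr1n.
under eq_bigr do rewrite mxE.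
by rewrite sumr_const card_ord -[LHS]mulr_natl divff ?gt_eqF.
Qed.

Theorem proposition3p2 (R : realType) (H W N M K : nat)
  (pix : 'I_N -> 'I_H * 'I_W) (idx : 'I_H * 'I_W -> 'I_N)
  (pixK : cancel pix idx) (idxK : cancel idx pix)
  (A : 'M[R]_(M, N)) (b : 'cV[R]_M) (K_ge2 : (2 <= K)%N)
  (mu sigma : 'I_K -> R) (sigma_gt0 : forall k, 0 < sigma k)
  (lambda_n lambda_t lambda_c : R)
  (lambda_n_gt0 : 0 < lambda_n) (lambda_t_gt0 : 0 < lambda_t)
  (lambda_c_gt0 : 0 < lambda_c)
  (u : nat -> 'cV[R]_N * 'M[R]_(N, K) * 'M[R]_(N, K)) :
  let F := objective pix idx A b mu sigma lambda_n lambda_t lambda_c in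
  alternating_minimization pix idx A b mu sigma lambda_n lambda_t lambda_c u ->
  forall z : 'cV[R]_N * 'M[R]_(N, K) * 'M[R]_(N, K),
    cluster_points_in (dom F) u z -> coordinatewise_min F z.
Proof.
move=> F [[_ d0E p0E] xmin dmin pmin] [[zx zd] zp] [domz uz].
have [[_ szd] szp] :
    (setT `*` simplexes (K := K) `*` simplexes (K := K)) (zx, zd, zp).
  by rewrite -(dom_objective pix idx A b mu sigma lambda_n lambda_t lambda_c).
set E := energy pix idx A b mu sigma lambda_n lambda_t lambda_c.
pose x n := (u n).1.1; pose d n := (u n).1.2; pose p n := (u n).2.
have FE y e q : simplexes e -> simplexes q -> F (y, e, q) = (E y e q)%:E.
  by move=> se sq; rewrite /F /objective asboolT.
have sd n : simplexes (d n).
  by case: n => [|n]; [rewrite /d d0E; exact: simplexes_const|case: (dmin n)].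
have sp n : simplexes (p n).
  by case: n => [|n]; [rewrite /p p0E; exact: simplexes_const|case: (pmin n)].
have {}xmin n y : E (x n.+1) (d n) (p n) <= E y (d n) (p n).
  by have [_ /(_ y I)] := xmin n; rewrite -/F -/(x n.+1) -/(d n) -/(p n) !FE.
have {}dmin n e : simplexes e ->
    E (x n.+1) (d n.+1) (p n) <= E (x n.+1) e (p n).
  move=> se; have [_ /(_ e se)] := dmin n.
  by rewrite -/F -/(d n.+1) -/(x n.+1) -/(p n) !FE.
have {}pmin n q : simplexes q ->
    E (x n.+1) (d n.+1) (p n.+1) <= E (x n.+1) (d n.+1) q.
  move=> sq; have [_ /(_ q sq)] := pmin n.
  by rewrite -/F -/(d n.+1) -/(x n.+1) -/(p n.+1) !FE.
pose e n := E (x n) (d n) (p n).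
(* The intermediate energies are kept: each block's minimality is later used at its own stage of the
   cycle. *)
have edecr_d n : e n.+1 <= E (x n.+1) (d n.+1) (p n) by exact: pmin.
have edecr_x n : e n.+1 <= E (x n.+1) (d n) (p n).
  exact: le_trans (edecr_d n) (dmin n _ (sd n)).
have edecr : nonincreasing_seq e.
  apply/nonincreasing_seqP => n.
  exact: le_trans (edecr_x n) (xmin n _).
have [G [GP ooG uG]] := cluster_eventually_filter _ _ uz.
have xG : x @ G --> zx by exact: cvg_comp _ _ (cvg_comp _ _ uG cvg_fst) cvg_fst.
have dG : d @ G --> zd by exact: cvg_comp _ _ (cvg_comp _ _ uG cvg_fst) cvg_snd.
have pG : p @ G --> zp by exact: cvg_comp _ _ uG cvg_snd.
have limE (X : nat -> 'cV[R]_N) (D P : nat -> 'M[R]_(N, K)) y f q :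
    X @ G --> y -> D @ G --> f -> P @ G --> q -> simplexes f -> simplexes q ->
    E (X n) (D n) (P n) @[n --> G] --> E y f q.
  exact: cvg_energy.
have ge_lim (f : nat -> R) (l c : R) : f n @[n --> G] --> l ->
    (forall n, c <= f n) -> c <= l.
  move=> fl cf; rewrite -(cvg_lim _ fl) //.
  by apply: limr_ge; [apply: cvgP fl|exact: nearW].
(* Along [G] the energies tend to that of [z], and from index [n] on they stay below [e n]. *)
have le_e n : E zx zd zp <= e n.
  have eG := limE _ _ _ _ _ _ xG dG pG szd szp.
  rewrite -(cvg_lim _ eG) //; apply: limr_le; first by apply: cvgP eG.
  apply: ooG; exists n => // m /= nm; exact: edecr.
have [c c0 gap] := energy_gap pix idx A b mu sigma lambda_n lambda_t lambda_c
  sigma_gt0 lambda_n_gt0 lambda_t_gt0.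
have cvge : cvgn e.
  apply: nonincreasing_is_cvgn => //.
  by exists (E zx zd zp) => _ [n _ <-].
have gap0 : e n - e n.+1 @[n --> \oo] --> (0 : R).
  rewrite -(subrr (limn e)); apply: cvgB => //.
  by rewrite (_ : (fun n => e n.+1) = [sequence e n.+1]_n) // cvg_shiftS.
have xS : x n.+1 - x n @[n --> \oo] --> (0 : 'cV[R]_N).
  apply: cvg_mx => i j; rewrite mxE ord1.
  have sq0 : (x n.+1 i 0 - x n i 0) ^+ 2 @[n --> \oo] --> (0 : R).
    apply: (@squeeze_cvgr _ _ _ _ (cst 0) (fun n => c^-1 * (e n - e n.+1))).
    - apply: nearW => n; rewrite sqr_ge0 /= -ler_pdivrMl ?invr_gt0// invrK.
      rewrite -sqrrN opprB.
      (* The gap is taken between the old and the new image with [d n] and [p n] frozen; the later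
         two updates only lower the energy further. *)
      apply: le_trans (gap _ _ _ _ i (sd n) (sp n) (xmin n)) _.
      by rewrite lerB.
    - exact: cvg_cst.
    - by rewrite -(mulr0 c^-1); apply: cvgM => //; exact: cvg_cst.
  apply: norm_cvg0.
  rewrite [X in X @ _]
    (_ : _ = Num.sqrt \o (fun n => (x n.+1 i 0 - x n i 0) ^+ 2)).
    by rewrite -sqrtr0; exact: continuous_cvg (@sqrt_continuous R 0) sq0.
  by apply/funext => n /=; rewrite sqrtr_sqr !mxE.
(* [G] need not be invariant under the shift, so this limit comes from the vanishing increments. It
   is needed because the second update pairs [x n.+1] with [p n]. *)
have xSG : x n.+1 @[n --> G] --> zx.
  rewrite -[zx]add0r.
  have -> : (fun n => x n.+1) = (fun n => x n.+1 - x n) \+ x.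
    by apply/funext => n /=; rewrite subrK.
  apply: cvgD xG => B /xS; exact: ooG.
have Fz : F (zx, zd, zp) = (E zx zd zp)%:E by exact: FE.
split=> //.
- move=> d1; rewrite Fz FE // lee_fin.
  have lim1 : E (zx + d1) (d n) (p n) @[n --> G] --> E (zx + d1) zd zp.
    by apply: (limE (cst (zx + d1))) => //; exact: cvg_cst.
  apply: (ge_lim _ _ _ lim1).
  move=> n; apply: le_trans (le_e n.+1) _.
  exact: le_trans (edecr_x n) (xmin n _).
(* A competitor outside the simplexes has value [+oo]; for the others the minimality of [d n.+1]
   passes to the limit. *)
- move=> d2; have [s2|s2] := asboolP (simplexes (zd + d2)); last first.
    by rewrite Fz /F /objective asboolF ?leey // => -[].
  rewrite Fz FE // lee_fin.
  have lim2 : E (x n.+1) (zd + d2) (p n) @[n --> G] --> E zx (zd + d2) zp.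
    by apply: (limE (fun n => x n.+1) (cst (zd + d2))) => //; exact: cvg_cst.
  apply: (ge_lim _ _ _ lim2).
  move=> n; apply: le_trans (le_e n.+1) _.
  exact: le_trans (edecr_d n) (dmin n _ s2).
- move=> d3; have [s3|s3] := asboolP (simplexes (zp + d3)); last first.
    by rewrite Fz /F /objective asboolF ?leey // => -[].
  rewrite Fz FE // lee_fin.
  have lim3 : E (x n) (d n) (zp + d3) @[n --> G] --> E zx zd (zp + d3).
    by apply: (limE _ _ (cst (zp + d3))) => //; exact: cvg_cst.
  rewrite -(cvg_lim _ lim3) //; apply: limr_ge; first by apply: cvgP lim3.
  (* The index 0 is excluded since [p 0] is the initial value and not a minimizer; for positive
     indices all blocks carry the same index, so no shift is involved. *)
  apply: ooG; exists 1%N => // -[|n] //= _.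
  by apply: le_trans (le_e n.+1) (pmin n _ s3).
Qed.
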